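(* Let $n=\frac{p}{q}$, where $p$ and $q$ are odd integers. For $i=1,2$ let $d_i$ be a nonzero real number, let $a_i,b_i$ be real-valued continuous functions on an interval $J$ containing $0$, and let $y_i$ be the unique solution, on an interval $I_i\subseteq J$ containing $0$, of the Bernoulli initial-value problem $$\frac{dy_i(t)}{dt}=a_i(t)y_i(t)+b_i(t)y_i^{n}(t),\qquad y_i(0)=d_i .$$ Then the following hold. (i) If $a_1$ is an odd function, $b_1$ is an even function, $a_2(t)=a_1(t)$, $b_2(t)=-b_1(t)$, and $d_2=-d_1$, then $y_1$ and $y_2$ are symmetric to each other with respect to the origin, i.e. $y_2(-t)=-y_1(t)$. (ii) If $a_2(t)=a_1(t)$, $b_2(t)=b_1(t)$, and $d_2=-d_1$, then $y_1$ and $y_2$ are symmetric to each other with respect to the $t$-axis, i.e. $y_2(t)=-y_1(t)$. (iii) If $a_1$ is an even function, $b_1$ is an odd function, $a_2(t)=-a_1(t)$, $b_2(t)=b_1(t)$, and $d_2=-d_1$, then $y_1$ and $y_2$ are symmetric to each other with respect to the origin, i.e. $y_2(-t)=-y_1(t)$. (iv) If $a_1$ and $b_1$ are even functions, $a_2(t)=-a_1(t)$, $b_2(t)=-b_1(t)$, and $d_2=-d_1$, then $y_1$ and $y_2$ are symmetric to each other with respect to the origin, i.e. $y_2(-t)=-y_1(t)$.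
   Context: Everything is real-valued. For $n=p/q$ with $q>0$ odd, $y^{n}$ means $(y^{1/q})^{p}$ with $y^{1/q}$ the real $q$-th root (so $y^n$ is defined for negative $y$; if $n<0$, solutions are nonvanishing). Intervals are nondegenerate; whenever a function on $J$ is said to be even or odd, $J$ is symmetric about $0$. ''The unique solution on $I_i$'' means that $I_i$ is an interval containing $0$ on which the $i$-th initial-value problem has exactly one solution, denoted $y_i$. The identity $y_2(-t)=-y_1(t)$ is understood for all $t$ with $t\in I_1$ and $-t\in I_2$; the identity $y_2(t)=-y_1(t)$ is understood for all $t\in I_1\cap I_2$. *)

(* Defs.v *)
From Stdlib Require Import Reals ZArith Lra Lia.
Open Scope R_scope.

Definition interval (I : R -> Prop) : Prop :=
  (exists s t, I s /\ I t /\ s < t) /\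
  (forall r s t, I r -> I t -> r <= s <= t -> I s).

Definition subset (I J : R -> Prop) : Prop := forall t, I t -> J t.

Definition continuous_on (J : R -> Prop) (f : R -> R) : Prop :=
  forall t, J t -> continue_in f J t.

Definition symmetric_set (J : R -> Prop) : Prop := forall t, J t -> J (- t).

(* Calling a function on J even or odd includes the symmetry of J about 0. *)
Definition even_on (J : R -> Prop) (f : R -> R) : Prop :=
  symmetric_set J /\ forall t, J t -> f (- t) = f t.

Definition odd_on (J : R -> Prop) (f : R -> R) : Prop :=
  symmetric_set J /\ forall t, J t -> f (- t) = - f t.

(* The real q-th root of y, for q > 0 odd.  [Rpower] has the intended meaning
   only for a positive base, hence the case distinction. *)
Definition odd_root (q : Z) (y : R) : R :=
  if Rlt_dec 0 y then Rpower y (/ IZR q)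
  else if Rlt_dec y 0 then - Rpower (- y) (/ IZR q)
  else 0.

(* y ^ (p / q) for q > 0 odd.  At y = 0 and p < 0 the value is a dummy one. *)
Definition rat_pow (p q : Z) (y : R) : R := powerRZ (odd_root q y) p.

(* y' = a y + b y^(p/q) on I, y(0) = d.  [D_in] is the derivative relative to
   I, that is, one-sided at an endpoint belonging to I.  As q > 0, the
   condition p < 0 says that the exponent is negative. *)
Definition bernoulli_solution (p q : Z) (a b : R -> R) (d : R)
    (I : R -> Prop) (y : R -> R) : Prop :=
  (forall t, I t ->
     D_in y (fun s => a s * y s + b s * rat_pow p q (y s)) I t) /\
  y 0 = d /\
  ((p < 0)%Z -> forall t, I t -> y t <> 0).

(* Functions on I are represented by total functions, whose values outside I
   are irrelevant: uniqueness means agreement on I. *)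
Definition unique_bernoulli_solution (p q : Z) (a b : R -> R) (d : R)
    (I : R -> Prop) (y : R -> R) : Prop :=
  bernoulli_solution p q a b d I y /\
  forall z, bernoulli_solution p q a b d I z -> forall t, I t -> z t = y t.

Lemma Rpower_inv_powerRZ (q : Z) (x : R) :
  (0 < q)%Z -> 0 < x -> powerRZ (Rpower x (/ IZR q)) q = x.
Proof.
intros Hq Hx.
rewrite powerRZ_Rpower by apply exp_pos.
rewrite Rpower_mult, Rinv_l, Rpower_1; auto.
apply not_0_IZR; lia.
Qed.

Lemma odd_root_spec (q : Z) (y : R) :
  (0 < q)%Z -> Z.Odd q -> powerRZ (odd_root q y) q = y.
Proof.
intros Hq [k Hk].
assert (Hk0 : (0 <= k)%Z) by lia.
assert (Eq : q = Z.of_nat (S (2 * Z.to_nat k))) by lia.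
unfold odd_root.
destruct (Rlt_dec 0 y) as [Hy|Hy]; [now apply Rpower_inv_powerRZ|].
destruct (Rlt_dec y 0) as [Hy'|Hy'].
- assert (H : powerRZ (Rpower (- y) (/ IZR q)) q = - y)
    by (apply Rpower_inv_powerRZ; [assumption | lra]).
  revert H; generalize (Rpower (- y) (/ IZR q)); intros r.
  rewrite Eq, <- !pow_powerRZ, <- !tech_pow_Rmult, !pow_mult.
  replace ((- r) ^ 2) with (r ^ 2) by ring.
  lra.
- rewrite Eq, <- pow_powerRZ, pow_i by lia.
  lra.
Qed.

(* Main.v *)
Require Import Defs.
From Stdlib Require Import Reals ZArith.
From Stdlib Require Import Lra Lia Classical.
Open Scope R_scope.

(** Since [p] and [q] are odd, the power [y^(p/q)] is an odd function of [y].
    Hence, for [s = 1] or [s = -1], the substitution [z t = - y (s t)] turns a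
    solution of [y' = a y + b y^n], [y 0 = d], into a solution of the Bernoulli
    problem with coefficients [s * a (s t)], [s * b (s t)] and initial value
    [-d] ([bernoulli_solution_reflect]).  The parity hypotheses of (i), (iii)
    and (iv) say that [a2], [b2] are these coefficients for [s = -1]; those of
    (ii) say so for [s = 1].  As the substitution is an involution, it also
    transports uniqueness ([unique_bernoulli_solution_reflect]), so
    [t |-> - y1 (s t)] and [y2] are the unique solutions of one and the same
    problem, on [s I1] and on [I2].

    It remains to see that they agree on the intersection although uniqueness
    on an interval is not assumed on its subintervals
    ([unique_bernoulli_solutions_agree]).  On each side of 0, one of the two
    intervals contains the other.  On that side, graft the solution living on
    the larger interval onto the one living on the smaller interval: both take
    the value [d] at 0, so both have the same derivative there and the result
    solves the problem on the whole smaller interval, where uniqueness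
    applies. *)

(** * The power function is odd *)

Lemma odd_root_opp (q : Z) (y : R) : odd_root q (- y) = - odd_root q y.
Proof.
unfold odd_root.
destruct (Rlt_dec 0 (- y)), (Rlt_dec (- y) 0), (Rlt_dec 0 y), (Rlt_dec y 0);
  try lra.
now rewrite Ropp_involutive.
Qed.

Lemma pow_opp_odd (n : nat) (x : R) : Nat.Odd n -> (- x) ^ n = - x ^ n.
Proof.
intros [k ->].
rewrite Nat.add_1_r, <- !tech_pow_Rmult, !pow_mult.
replace ((- x) ^ 2) with (x ^ 2) by ring.
ring.
Qed.

Lemma powerRZ_opp_odd (p : Z) (x : R) :
  Z.Odd p -> powerRZ (- x) p = - powerRZ x p.
Proof.
intros [k Hk].
destruct p as [|p|p]; [lia| |]; simpl; rewrite pow_opp_odd.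
- reflexivity.
- exists (Z.to_nat k); lia.
- apply Rinv_opp.
- exists (Z.to_nat (- k - 1)); lia.
Qed.

Lemma rat_pow_opp (p q : Z) (y : R) :
  Z.Odd p -> rat_pow p q (- y) = - rat_pow p q y.
Proof.
intros Hp; unfold rat_pow.
rewrite odd_root_opp; now apply powerRZ_opp_odd.
Qed.

(** * Relative derivatives *)

Lemma D_in_restrict (f g df dg : R -> R) (D E : R -> Prop) (t : R) :
  D_in f df D t -> (forall x, E x -> D x) ->
  (forall x, E x -> g x = f x) -> g t = f t -> dg t = df t ->
  D_in g dg E t.
Proof.
intros Hf HED Hgf Ht Hd eps Heps.
destruct (Hf eps Heps) as [al [Hal H]].
exists al; split; [exact Hal|].
intros x [[HEx Hne] Hx].
rewrite (Hgf x HEx), Ht, Hd.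
apply H; split; [split|]; auto.
Qed.

Lemma D_in_union (f df : R -> R) (A B D : R -> Prop) (t : R) :
  D_in f df A t -> D_in f df B t -> (forall x, D x -> A x \/ B x) ->
  D_in f df D t.
Proof.
intros HA HB HD eps Heps.
destruct (HA eps Heps) as [al [Hal H]].
destruct (HB eps Heps) as [be [Hbe H']].
exists (Rmin al be); split; [now apply Rmin_pos|].
intros x [[HDx Hne] Hx].
destruct (HD x HDx) as [HAx|HBx]; [apply H|apply H'];
  (split; [now split|]);
  (eapply Rlt_le_trans; [exact Hx|]); [apply Rmin_l|apply Rmin_r].
Qed.

(** The limit defining the derivative ranges over the empty set once it is
    taken near [t], so it can have any value. *)
Lemma D_in_isolated (f df : R -> R) (D : R -> Prop) (t del : R) :
  0 < del -> (forall x, D x -> del <= Rabs (x - t)) -> D_in f df D t.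
Proof.
intros Hdel HD eps Heps.
exists del; split; [exact Hdel|].
intros x [[HDx _] Hx]; simpl in Hx; unfold Rdist in Hx.
specialize (HD x HDx); lra.
Qed.

(** * Reflection of solutions *)

(** The sign [s] treats the reflection in the [t]-axis ([s = 1]) and in the
    origin ([s = -1]) together.  That the coefficients are related on [K] only
    is what lets the lemma be applied to its own conclusion. *)
Lemma bernoulli_solution_reflect (p q : Z) (s : R) (a b a' b' : R -> R)
    (d : R) (I K : R -> Prop) (y : R -> R) :
  Z.Odd p -> s = 1 \/ s = -1 ->
  (forall t, K t -> I (s * t)) ->
  (forall t, K t -> a' t = s * a (s * t)) ->
  (forall t, K t -> b' t = s * b (s * t)) ->
  bernoulli_solution p q a b d I y ->
  bernoulli_solution p q a' b' (- d) K (fun t => - y (s * t)).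
Proof.
intros Hp Hs HK Ha Hb [Hy [H0 Hn]]; split; [|split].
- intros t Ht.
  pose proof (Dmult_const K _ _ t s (Dx K t)) as Hlin.
  pose proof (Dopp _ _ _ _
    (Dcomp _ _ _ _ _ _ t Hlin (Hy (s * t) (HK t Ht)))) as Hc.
  apply (D_in_restrict _ _ _ _ _ _ _ Hc); auto.
  + intros x Hx; split; auto.
  + simpl.
    rewrite (Ha t Ht), (Hb t Ht), rat_pow_opp by exact Hp; ring.
- now rewrite Rmult_0_r, H0.
- intros Hlt t Ht.
  apply Ropp_neq_0_compat, Hn; auto.
Qed.

(** A competitor [z] on [K] is reflected back to [I], where uniqueness is
    known; here [s * s = 1]. *)
Lemma unique_bernoulli_solution_reflect (p q : Z) (s : R)
    (a b a' b' : R -> R) (d : R) (I : R -> Prop) (y : R -> R) :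
  Z.Odd p -> s = 1 \/ s = -1 ->
  (forall t, I (s * t) -> a' t = s * a (s * t)) ->
  (forall t, I (s * t) -> b' t = s * b (s * t)) ->
  unique_bernoulli_solution p q a b d I y ->
  unique_bernoulli_solution p q a' b' (- d)
    (fun t => I (s * t)) (fun t => - y (s * t)).
Proof.
intros Hp Hs Ha Hb [Hy Hu]; split.
- now apply (bernoulli_solution_reflect p q s a b a' b' d I).
- intros z Hz t Ht.
  assert (Hss : forall x, s * (s * x) = x) by (intros x; destruct Hs; subst; ring).
  assert (Hback : bernoulli_solution p q a b d I (fun x => - z (s * x))).
  { rewrite <- (Ropp_involutive d).
    apply (bernoulli_solution_reflect p q s a' b' a b (- d)
             (fun t => I (s * t)) I); auto; intros x Hx;
      [rewrite Hss|rewrite Ha|rewrite Hb]; rewrite ?Hss; auto. }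
  generalize (Hu _ Hback (s * t) Ht).
  rewrite Hss; lra.
Qed.

(** * Agreement of unique solutions on different intervals *)

(** The sign [e] selects the side [0 <= e * t] of 0 on which [v] replaces [u].
    At 0 both pieces have the derivative that the equation prescribes, because
    [u 0 = v 0 = d]; at any other point one of the two pieces is not seen by
    the derivative. *)
Lemma bernoulli_solution_graft (p q : Z) (a b : R -> R) (d e : R)
    (I K : R -> Prop) (u v : R -> R) :
  e = 1 \/ e = -1 ->
  (forall t, I t -> 0 <= e * t -> K t) ->
  bernoulli_solution p q a b d I u ->
  bernoulli_solution p q a b d K v ->
  bernoulli_solution p q a b d I
    (fun t => if Rle_dec 0 (e * t) then v t else u t).
Proof.
intros He HIK [Hu [Hu0 Hun]] [Hv [Hv0 Hvn]].
set (z := fun t => if Rle_dec 0 (e * t) then v t else u t).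
assert (Hzv : forall t, 0 <= e * t -> z t = v t)
  by (intros t Ht; unfold z; destruct (Rle_dec 0 (e * t)); tauto).
assert (Hzu : forall t, e * t <= 0 -> z t = u t).
{ intros t Ht; unfold z; destruct (Rle_dec 0 (e * t)); [|reflexivity].
  assert (t = 0) as -> by (destruct He; subst; lra).
  now rewrite Hu0, Hv0. }
split; [|split].
- intros t Ht.
  apply (D_in_union _ _ (fun x => I x /\ 0 <= e * x)
                        (fun x => I x /\ e * x <= 0)).
  + destruct (Rle_or_lt 0 (e * t)) as [H|H].
    * apply (D_in_restrict _ _ _ _ _ _ _ (Hv t (HIK t Ht H))); auto.
      -- intros x [Hx Hx']; auto.
      -- intros x [_ Hx]; auto.
      -- simpl; now rewrite Hzv.
    * apply (D_in_isolated _ _ _ _ (- (e * t))); [lra|].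
      intros x [_ Hx]; unfold Rabs; destruct (Rcase_abs (x - t)), He; subst; lra.
  + destruct (Rle_or_lt (e * t) 0) as [H|H].
    * apply (D_in_restrict _ _ _ _ _ _ _ (Hu t Ht)); auto.
      -- intros x [Hx _]; auto.
      -- intros x [_ Hx]; auto.
      -- simpl; now rewrite Hzu.
    * apply (D_in_isolated _ _ _ _ (e * t)); [lra|].
      intros x [_ Hx]; unfold Rabs; destruct (Rcase_abs (x - t)), He; subst; lra.
  + intros x Hx; destruct (Rle_or_lt 0 (e * x)); [left|right]; split; auto; lra.
- now rewrite Hzv by lra.
- intros Hlt t Ht; destruct (Rle_or_lt 0 (e * t)) as [H|H].
  + rewrite Hzv; auto.
  + rewrite Hzu by lra; auto.
Qed.

Lemma unique_bernoulli_solution_agree_side (p q : Z) (a b : R -> R) (d e : R)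
    (I K : R -> Prop) (u v : R -> R) (t : R) :
  e = 1 \/ e = -1 ->
  (forall t, I t -> 0 <= e * t -> K t) ->
  unique_bernoulli_solution p q a b d I u ->
  bernoulli_solution p q a b d K v ->
  I t -> 0 <= e * t -> v t = u t.
Proof.
intros He HIK [Hu Huniq] Hv Ht Het.
generalize (Huniq _ (bernoulli_solution_graft p q a b d e I K u v
                       He HIK Hu Hv) t Ht).
simpl; destruct (Rle_dec 0 (e * t)); tauto.
Qed.

(** A point of [I] missed by [K] bounds [K] on its side of 0, hence lies
    beyond all points of [K] there. *)
Lemma interval_side_nested (e : R) (I K : R -> Prop) :
  e = 1 \/ e = -1 -> interval I -> I 0 -> interval K -> K 0 ->
  (forall t, I t -> 0 <= e * t -> K t) \/
  (forall t, K t -> 0 <= e * t -> I t).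
Proof.
intros He [_ HI] HI0 [_ HK] HK0.
destruct (classic (exists r, I r /\ 0 <= e * r /\ ~ K r))
  as [[r [Hr [Her HnK]]]|Hno].
- right; intros t Ht Het.
  destruct (Rle_or_lt (e * r) (e * t)) as [H|H].
  + exfalso; apply HnK.
    destruct He; subst; [apply (HK 0 r t)|apply (HK t r 0)]; auto; lra.
  + destruct He; subst; [apply (HI 0 t r)|apply (HI r t 0)]; auto; lra.
- left; intros t Ht Het.
  apply NNPP; intros HnK; apply Hno; now exists t.
Qed.

Lemma unique_bernoulli_solutions_agree (p q : Z) (a b : R -> R) (d : R)
    (I K : R -> Prop) (u v : R -> R) (t : R) :
  interval I -> I 0 -> interval K -> K 0 ->
  unique_bernoulli_solution p q a b d I u ->
  unique_bernoulli_solution p q a b d K v ->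
  I t -> K t -> u t = v t.
Proof.
intros HI HI0 HK HK0 Hu Hv HIt HKt.
assert (Hside : exists e, (e = 1 \/ e = -1) /\ 0 <= e * t).
{ destruct (Rle_or_lt 0 t); [exists 1|exists (-1)]; split; auto; lra. }
destruct Hside as [e [He Het]].
destruct (interval_side_nested e I K He HI HI0 HK HK0) as [H|H].
- symmetry.
  exact (unique_bernoulli_solution_agree_side p q a b d e I K u v t
           He H Hu (proj1 Hv) HIt Het).
- exact (unique_bernoulli_solution_agree_side p q a b d e K I v u t
           He H Hv (proj1 Hu) HKt Het).
Qed.

(** * Symmetry of solutions *)

Lemma interval_reflect (s : R) (I : R -> Prop) :
  s = 1 \/ s = -1 -> interval I -> interval (fun t => I (s * t)).
Proof.
intros Hs [[x [y [Hx [Hy Hxy]]]] HI]; split.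
- destruct Hs; subst; [exists x, y|exists (- y), (- x)]; repeat split;
    try lra; [now rewrite Rmult_1_l|now rewrite Rmult_1_l| |];
    [replace (-1 * - y) with y by ring|replace (-1 * - x) with x by ring];
    assumption.
- intros r t w Hr Hw H; destruct Hs; subst;
    [apply (HI (1 * r) _ (1 * w))|apply (HI (-1 * w) _ (-1 * r))]; auto; lra.
Qed.

(** All four cases of the theorem are instances of this one. *)
Lemma unique_bernoulli_solution_symmetry (p q : Z) (s : R)
    (a1 b1 a2 b2 : R -> R) (d : R) (I1 I2 : R -> Prop) (y1 y2 : R -> R)
    (t : R) :
  Z.Odd p -> s = 1 \/ s = -1 ->
  interval I1 -> I1 0 -> interval I2 -> I2 0 ->
  (forall t, I1 (s * t) -> a2 t = s * a1 (s * t)) ->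
  (forall t, I1 (s * t) -> b2 t = s * b1 (s * t)) ->
  unique_bernoulli_solution p q a1 b1 d I1 y1 ->
  unique_bernoulli_solution p q a2 b2 (- d) I2 y2 ->
  I1 t -> I2 (s * t) -> y2 (s * t) = - y1 t.
Proof.
intros Hp Hs HI1 H10 HI2 H20 Ha Hb Hy1 Hy2 Ht1 Ht2.
assert (Hss : s * (s * t) = t) by (destruct Hs; subst; ring).
pose proof (unique_bernoulli_solution_reflect p q s a1 b1 a2 b2 d I1 y1
              Hp Hs Ha Hb Hy1) as Hz.
rewrite (unique_bernoulli_solutions_agree p q a2 b2 (- d) I2
           (fun t => I1 (s * t)) y2 (fun t => - y1 (s * t)) (s * t));
  rewrite ?Hss, ?Rmult_0_r; auto.
now apply interval_reflect.
Qed.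

Theorem theorem4
  (p q : Z) (hp : Z.Odd p) (hq : Z.Odd q) (hq0 : (0 < q)%Z)
  (d1 d2 : R) (hd1 : d1 <> 0) (hd2 : d2 <> 0)
  (J : R -> Prop) (hJ : interval J) (hJ0 : J 0)
  (a1 b1 a2 b2 : R -> R)
  (ha1 : continuous_on J a1) (hb1 : continuous_on J b1)
  (ha2 : continuous_on J a2) (hb2 : continuous_on J b2)
  (I1 I2 : R -> Prop)
  (hI1 : interval I1) (hI10 : I1 0) (hI1J : subset I1 J)
  (hI2 : interval I2) (hI20 : I2 0) (hI2J : subset I2 J)
  (y1 y2 : R -> R)
  (hy1 : unique_bernoulli_solution p q a1 b1 d1 I1 y1)
  (hy2 : unique_bernoulli_solution p q a2 b2 d2 I2 y2) :
  (odd_on J a1 -> even_on J b1 ->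
   (forall t, J t -> a2 t = a1 t) -> (forall t, J t -> b2 t = - b1 t) ->
   d2 = - d1 ->
   forall t, I1 t -> I2 (- t) -> y2 (- t) = - y1 t)
  /\
  ((forall t, J t -> a2 t = a1 t) -> (forall t, J t -> b2 t = b1 t) ->
   d2 = - d1 ->
   forall t, I1 t -> I2 t -> y2 t = - y1 t)
  /\
  (even_on J a1 -> odd_on J b1 ->
   (forall t, J t -> a2 t = - a1 t) -> (forall t, J t -> b2 t = b1 t) ->
   d2 = - d1 ->
   forall t, I1 t -> I2 (- t) -> y2 (- t) = - y1 t)
  /\
  (even_on J a1 -> even_on J b1 ->
   (forall t, J t -> a2 t = - a1 t) -> (forall t, J t -> b2 t = - b1 t) ->
   d2 = - d1 ->
   forall t, I1 t -> I2 (- t) -> y2 (- t) = - y1 t).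
Proof.
(* The reflected problem lives on [- I1]; the relations between the
   coefficients are given on [J], which contains [- I1] by symmetry. *)
assert (HJ1 : symmetric_set J -> forall t, I1 (-1 * t) -> J t).
{ intros Hsym t Ht; rewrite <- (Ropp_involutive t).
  apply Hsym, hI1J; now replace (- t) with (-1 * t) by ring. }
assert (Hneg : forall t, - t = -1 * t) by (intros; ring).
split; [|split; [|split]].
- intros [Hsym Ea] [_ Eb] E2a E2b -> t Ht1 Ht2.
  rewrite (Hneg t) in *.
  apply (unique_bernoulli_solution_symmetry p q (-1) a1 b1 a2 b2 d1 I1 I2);
    auto; intros x Hx; rewrite <- (Hneg x); pose proof (HJ1 Hsym x Hx);
    [rewrite E2a, Ea|rewrite E2b, Eb]; auto; ring.
- intros E2a E2b -> t Ht1 Ht2.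
  rewrite <- (Rmult_1_l t) in Ht2 |- * at 1.
  apply (unique_bernoulli_solution_symmetry p q 1 a1 b1 a2 b2 d1 I1 I2);
    auto; intros x Hx; rewrite !Rmult_1_l in *; auto.
- intros [Hsym Ea] [_ Eb] E2a E2b -> t Ht1 Ht2.
  rewrite (Hneg t) in *.
  apply (unique_bernoulli_solution_symmetry p q (-1) a1 b1 a2 b2 d1 I1 I2);
    auto; intros x Hx; rewrite <- (Hneg x); pose proof (HJ1 Hsym x Hx);
    [rewrite E2a, Ea|rewrite E2b, Eb]; auto; ring.
- intros [Hsym Ea] [_ Eb] E2a E2b -> t Ht1 Ht2.
  rewrite (Hneg t) in *.
  apply (unique_bernoulli_solution_symmetry p q (-1) a1 b1 a2 b2 d1 I1 I2);
    auto; intros x Hx; rewrite <- (Hneg x); pose proof (HJ1 Hsym x Hx);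
    [rewrite E2a, Ea|rewrite E2b, Eb]; auto; ring.
Qed.
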